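(* Let $1\le h\le n$ and $0\le l\le h-1$ be integers. For any $0\le a\le h-l-1$ and $0\le b\le n-h$, $$A_{a,b}^{(n,h,\lambda,1/2)}=\frac{(-1)^a\lambda^{n-1}2^b}{2^{2n-1}}\sum_{i_2=0}^a\frac{2^{a-i_2}}{\lambda^{a-i_2}}\binom{h}{i_2}\binom{2n+h+2-b}{a-i_2}\sum_{i=0}^b\binom{n}{i}\binom{n}{b-i}\frac{1}{\lambda^i}\;{}_2F_1\left(i_2-a,\,b-i-n-h-2,\,b-2n-h-2;\,1-\lambda\right).$$
   Context: Here $\lambda\in(0,1]$, and for $\theta\in(0,1)$ $$A_{a,b}^{(n,h,\lambda,\theta)}=(-1)^a\sum_{i=0}^b\binom{n}{i}\binom{n}{b-i}\sum_{i_1+i_2+i_3+i_4+i_5=a}\binom{2}{i_1}\binom{h}{i_2}\binom{h}{i_3}\binom{n-i}{i_4}\binom{n-(b-i)}{i_5}2^{i_1}(1-\theta)^{h-i_3}(\theta\lambda)^{n-1-i-i_4}\theta^{(n-h)-(b-i)-i_5},$$ the inner sum being over nonnegative integers; $A_{a,b}^{(n,h,\lambda,1/2)}$ is its value at $\theta=1/2$. ${}_2F_1(x,y,c;z)=\sum_{i\ge0}\frac{(x)_i(y)_i}{(c)_i\,i!}z^i$ is the Gauss hypergeometric function with $(x)_i=x(x+1)\cdots(x+i-1)$; here it is terminating: with first parameter $i_2-a=-N$, $N\ge0$ an integer, the sum runs over $0\le i\le N$. *)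

(* Defs.v *)
From HB Require Import structures.
From mathcomp Require Import all_boot all_order all_algebra.
From mathcomp Require Import reals.
Set Implicit Arguments.
Unset Strict Implicit.
Unset Printing Implicit Defensive.
Import Order.TTheory GRing.Theory Num.Theory.
Local Open Scope ring_scope.

Definition pochhammer (R : realType) (x : R) (i : nat) : R :=
  \prod_(0 <= j < i) (x + j%:R).

(* Terminating Gauss hypergeometric function 2F1(-N, y, c; z): the sum stops
   at i = N, the last index at which (-N)_i can be nonzero.  It is meaningful
   when (c)_i != 0 for all i <= N. *)
Definition hyp2F1 (R : realType) (N : nat) (y c z : R) : R :=
  \sum_(0 <= i < N.+1)
    pochhammer (- N%:R) i * pochhammer y i / (pochhammer c i * i`!%:R) * z ^+ i.

(* The powers of theta * lambda, theta and 1 - theta have exponents in int: in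
   particular (n - h) - (b - i) - i5 may be negative.  The natural-number
   subtractions n - i and n - (b - i) truncate only when 'C(n, i) = 0 or
   'C(n, b - i) = 0, respectively. *)
Definition Acoef (R : realType) (n h : nat) (lambda theta : R) (a b : nat) : R :=
  (-1) ^+ a *
  \sum_(0 <= i < b.+1) 'C(n, i)%:R * 'C(n, b - i)%:R *
    \sum_(i1 < a.+1) \sum_(i2 < a.+1) \sum_(i3 < a.+1) \sum_(i4 < a.+1)
    \sum_(i5 < a.+1 | (i1 + i2 + i3 + i4 + i5 == a)%N)
      'C(2, i1)%:R * 'C(h, i2)%:R * 'C(h, i3)%:R
      * 'C(n - i, i4)%:R * 'C(n - (b - i), i5)%:R
      * 2 ^+ i1
      * (1 - theta) ^ (h%:Z - i3%:Z)
      * (theta * lambda) ^ (n%:Z - 1 - i%:Z - i4%:Z)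
      * theta ^ ((n%:Z - h%:Z) - (b%:Z - i%:Z) - i5%:Z).

(* Main.v *)
Require Import Defs.
From HB Require Import structures.
From mathcomp Require Import all_boot all_order all_algebra.
From mathcomp Require Import reals.
From mathcomp Require Import ring zify.
Import Order.TTheory GRing.Theory Num.Theory.
Local Open Scope ring_scope.

(** The identity is proved by reading both sides as coefficients of one
    polynomial.  At theta = 1/2 every power of 2 in a summand depends on the
    summation indices only through i1 + i3 + i4 + i5 [powers_at_half], so for
    fixed i the inner sum is, up to a common factor, the convolution of five
    binomial sequences, that is [sum_coef5], the coefficient of X^a in
      (1 + 2X)^2 (1 + X)^h (1 + 2X)^h (1 + (2/lambda) X)^(n-i) (1 + 2X)^(n-b+i).
    The factors in 1 + 2X merge into (1 + 2X)^p with p = n + h + 2 - (b - i).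
    Splitting off (1 + X)^h produces the sum over i2 with its 'C(h, i2), and
    what is left is the coefficient of X^N, N = a - i2, in
      (1 + 2X)^p (1 + (2/lambda) X)^q,  with q = n - i.

    That coefficient is a terminating 2F1 [coef_binomialM_hyp2F1].  With
    c = 2/lambda and z = 1 - lambda one has 2 = c (1 - z), so that
    1 + 2X = (1 + cX) - czX; expanding its p-th power around 1 + cX gives
      sum_j 'C(p, j) (-z)^j c^N 'C(p + q - j, N - j),
    and 'C(p + q - j, N - j) is 'C(p + q, N) times a ratio of falling
    factorials, which are Pochhammer symbols at negative integers. *)

Lemma coef_binomial (R : comNzRingType) (c : R) (m k : nat) :
  ((1 + c *: 'X) ^+ m)`_k = 'C(m, k)%:R * c ^+ k.
Proof.
rewrite exprDn.
under eq_bigr => i _ do rewrite expr1n mul1r exprZn -scaler_nat scalerA.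
by rewrite -(poly_def m.+1 (fun i => 'C(m, i)%:R * c ^+ i)) coef_poly ltnS; case: leqP => // /bin_small ->; rewrite mul0r.
Qed.

(** One step of an iterated convolution: the power of X records the partial sum
    of the indices chosen so far, so nested sums can be absorbed one by one,
    from the innermost outwards. *)
Lemma sum_coef_shift (R : comNzRingType) (F G : {poly R}) (s a : nat) :
  \sum_(i < a.+1) F`_i * ('X^(s + i) * G)`_a = ('X^s * (F * G))`_a.
Proof.
rewrite mulrCA coefM; apply: eq_bigr => i _; congr (_ * _).
have := ltn_ord i; rewrite ltnS => ia.
rewrite !coefXnM ltn_subLR // addnC; case: ifP => // _.
by rewrite [(i + s)%N]addnC subnDAC.
Qed.

(** The innermost sum of an iterated convolution, where the constraint selects
    at most one index. *)
Lemma sum_coef_last (R : comNzRingType) (F : {poly R}) (s a : nat) :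
  \sum_(i < a.+1 | (s + i == a)%N) F`_i = ('X^s * F)`_a.
Proof.
rewrite -[F in RHS]mulr1 -sum_coef_shift big_mkcond; apply: eq_bigr => i _.
by rewrite mulr1 coefXn eq_sym; case: eqP; rewrite ?mulr1 ?mulr0.
Qed.

Lemma sum_coef5 (R : comNzRingType) (F1 F2 F3 F4 F5 : {poly R}) (a : nat) :
  \sum_(i1 < a.+1) \sum_(i2 < a.+1) \sum_(i3 < a.+1) \sum_(i4 < a.+1)
    \sum_(i5 < a.+1 | (i1 + i2 + i3 + i4 + i5 == a)%N)
      F1`_i1 * (F2`_i2 * (F3`_i3 * (F4`_i4 * F5`_i5)))
  = (F1 * (F2 * (F3 * (F4 * F5))))`_a.
Proof.
rewrite -[F1 * _]mul1r -(expr0 'X) -sum_coef_shift.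
apply: eq_bigr => i1 _; rewrite add0n -sum_coef_shift mulr_sumr.
apply: eq_bigr => i2 _; rewrite -sum_coef_shift !mulr_sumr.
apply: eq_bigr => i3 _; rewrite -sum_coef_shift !mulr_sumr.
apply: eq_bigr => i4 _; rewrite -sum_coef_last !mulr_sumr.
by [].
Qed.

Lemma pochhammerN (R : realType) (m j : nat) :
  pochhammer (- m%:R : R) j = (-1) ^+ j * (m ^_ j)%:R.
Proof.
rewrite /pochhammer; elim: j => [|j IHj]; first by rewrite big_geq // mul1r.
rewrite big_nat_recr //= IHj ffactnSr natrM exprSr.
case: (leqP j m) => [jm|/ffact_small ->]; last by rewrite !mulr0n; ring.
by rewrite natrB //; ring.
Qed.

(** This turns the binomials 'C(M - j, N - j) of the expansion into the quotient
    (-N)_j / (-M)_j of a hypergeometric term; it is stated without division so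
    that it holds in nat. *)
Lemma bin_sub_ffact (M N j : nat) : (j <= N)%N -> (N <= M)%N ->
  ('C(M - j, N - j) * M ^_ j = 'C(M, N) * N ^_ j)%N.
Proof.
elim: j M N => [|j IHj] M N; first by rewrite !subn0 !ffactn0.
case: M N => [|M] [|N] // jN NM.
rewrite !subSS !ffactSS mulnCA IHj // mulnA.
by rewrite (mul_bin_diag M.+1) mulnA [(N.+1 * _)%N]mulnC.
Qed.

(** Write 1 + c (1 - z) X = (1 + cX) - czX and expand the p-th power: the j-th
    term contributes (1 + cX)^(p + q - j), whose coefficients are explicit.  The
    bound on N keeps the denominators (-(p + q))_j away from 0. *)
Lemma coef_binomialM_hyp2F1 (R : realType) (c z : R) (p q N : nat) :
  (N <= p + q)%N ->
  ((1 + (c * (1 - z)) *: 'X) ^+ p * (1 + c *: 'X) ^+ q)`_N =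
  c ^+ N * 'C(p + q, N)%:R * hyp2F1 N (- p%:R) (- (p + q)%:R) z.
Proof.
move=> NM.
have -> : 1 + (c * (1 - z)) *: 'X = (1 + c *: 'X) + (- (c * z)) *: 'X :> {poly R}.
  by rewrite -addrA -scalerDl mulrBr mulr1.
rewrite exprDn mulr_suml coef_sum /hyp2F1.
have coef_term j : (j <= p)%N ->
    ((1 + c *: 'X) ^+ (p - j) * (- (c * z) *: 'X) ^+ j *+ 'C(p, j)
       * (1 + c *: 'X) ^+ q)`_N =
    if (N < j)%N then 0 else
    c ^+ N * 'C(p + q - j, N - j)%:R * 'C(p, j)%:R * (- z) ^+ j.
  move=> jp.
  have -> : (1 + c *: 'X) ^+ (p - j) * (- (c * z) *: 'X) ^+ j *+ 'C(p, j)
       * (1 + c *: 'X) ^+ q =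
     ('C(p, j)%:R * (- (c * z)) ^+ j) *: ('X^j * (1 + c *: 'X) ^+ (p + q - j)).
    rewrite exprZn -addnBAC // exprD mulrnAl -scalerAr -scalerAl -scaler_nat.
    by rewrite scalerA; congr (_ *: _); ring.
  rewrite coefZ coefXnM coef_binomial; case: ltnP => jN; first by rewrite mulr0.
  have -> : c ^+ N = c ^+ (N - j) * c ^+ j by rewrite -exprD subnK.
  by rewrite -mulrN exprMn; ring.
rewrite mulr_sumr big_mkord.
pose T j : R := c ^+ N * 'C(p + q - j, N - j)%:R * 'C(p, j)%:R * (- z) ^+ j.
transitivity (\sum_(j < N.+1) T j).
  transitivity (\sum_(j < p.+1) if (N < j)%N then 0 else T j).
    by apply: eq_bigr => j _; apply: coef_term; rewrite -ltnS.
  (* The binomial expansion stops at j = p, the 2F1 at j = N; both are extended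
     to a common range, the added terms being 0. *)
  rewrite (big_ord_widen (p + q).+1 (fun j => if (N < j)%N then 0 else T j));
    last by rewrite ltnS leq_addr.
  rewrite [RHS](big_ord_widen (p + q).+1) // big_mkcond [RHS]big_mkcond.
  apply: eq_bigr => j _; rewrite !ltnS; case: (leqP j N) => jN; case: leqP => // jp.
  by rewrite /T (bin_small jp) mulr0 mul0r.
apply: eq_bigr => j _; rewrite /T.
have jN : (j <= N)%N by rewrite -ltnS.
have jM : (j <= p + q)%N by apply: leq_trans jN NM.
have M0 : ((p + q) ^_ j)%:R != 0 :> R by rewrite pnatr_eq0 -lt0n ffact_gt0.
have j0 : j`!%:R != 0 :> R by rewrite pnatr_eq0 -lt0n fact_gt0.
have := congr1 (fun k => k%:R : R) (bin_sub_ffact _ _ _ jN NM); rewrite !natrM => E.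
rewrite !pochhammerN -(bin_ffact p) natrM.
have -> : 'C(p + q - j, N - j)%:R = 'C(p + q, N)%:R * (N ^_ j)%:R / ((p + q) ^_ j)%:R :> R.
  by rewrite -E mulfK.
have s0 : (-1) ^+ j != 0 :> R by rewrite signr_eq0.
rewrite -[- z]mulN1r exprMn; field.
by rewrite M0 j0.
Qed.

(** The index i cancels between the last two powers of 1/2, so the exponent of 2
    is i1 + i3 + i4 + i5 plus the constant b - (2n - 1); each index thereby
    attaches to its own binomial factor. *)
Lemma powers_at_half (R : realFieldType) (lambda : R) (n h b i i1 i3 i4 i5 : nat) :
  lambda != 0 -> (0 < n)%N ->
  2 ^+ i1 * (1 - 1 / 2) ^ (h%:Z - i3%:Z)
    * (1 / 2 * lambda) ^ (n%:Z - 1 - i%:Z - i4%:Z)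
    * (1 / 2) ^ ((n%:Z - h%:Z) - (b%:Z - i%:Z) - i5%:Z) =
  lambda ^+ (n - 1) * 2 ^+ b / 2 ^+ (2 * n - 1) * (1 / lambda ^+ i)
    * (2 ^+ i1 * 2 ^+ i3 * (2 / lambda) ^+ i4 * 2 ^+ i5).
Proof.
move=> l0 n0; have u0 : (2 : R) != 0 by rewrite pnatr_eq0.
have -> : 1 - 1 / 2 = 2^-1 :> R by field.
rewrite !div1r !opprB !expfzMl !expfzDr ?mulf_neq0 ?invr_eq0 // -!exprz_inv !invrK.
rewrite !expr1z -!exprnP expr_div_n mul2n -addnn.
have -> : lambda ^+ (n - 1) = lambda ^+ n / lambda by rewrite expfB_cond // (negPf l0).
have -> : (2 : R) ^+ (n + n - 1) = 2 ^+ n * 2 ^+ n / 2.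
  by apply: (mulIf u0); rewrite divfK // -exprSr -exprD subn1 prednK ?addn_gt0 ?n0.
rewrite !exprVn.
(* The powers are abstracted to nonzero scalars, which makes the identity one
   that the field tactic decides. *)
have := (expf_neq0 h u0, expf_neq0 n u0, expf_neq0 i u0, expf_neq0 i4 l0, expf_neq0 i l0).
move: (2 ^+ h) (2 ^+ n) (2 ^+ i) (lambda ^+ i4) (lambda ^+ i) => x1 x2 x3 x4 x5.
case=> [[[[x10 x20] x30] x40] x50]; field.
by rewrite x10 x20 x30 x40 x50 l0.
Qed.

Theorem proposition7 (R : realType) (lambda : R) (n h l a b : nat)
    (hlambda : 0 < lambda <= 1)
    (hh : (1 <= h <= n)%N) (hl : (l <= h - 1)%N)
    (ha : (a <= h - l - 1)%N) (hb : (b <= n - h)%N) :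
  Acoef n h lambda (1 / 2) a b =
  (-1) ^+ a * lambda ^+ (n - 1) * 2 ^+ b / 2 ^+ (2 * n - 1) *
  \sum_(0 <= i2 < a.+1)
    2 ^+ (a - i2) / lambda ^+ (a - i2)
    * 'C(h, i2)%:R * 'C(2 * n + h + 2 - b, a - i2)%:R
    * \sum_(0 <= i < b.+1)
        'C(n, i)%:R * 'C(n, b - i)%:R * (1 / lambda ^+ i)
        * hyp2F1 (a - i2) (b%:R - i%:R - n%:R - h%:R - 2)
                 (b%:R - 2 * n%:R - h%:R - 2) (1 - lambda).
Proof.
have l0 : lambda != 0 by case/andP: hlambda => /lt0r_neq0.
pose K : R := lambda ^+ (n - 1) * 2 ^+ b / 2 ^+ (2 * n - 1).
rewrite /Acoef -!mulrA; congr (_ * _); rewrite !mulrA -/K mulr_sumr.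
under [RHS]eq_bigr do rewrite !mulr_sumr.
rewrite exchange_big /= ; apply: eq_big_nat => i /andP[_ ib].
pose B m c : {poly R} := (1 + c *: 'X) ^+ m.
pose Q := B (n + h + 2 - (b - i))%N 2 * B (n - i)%N (2 / lambda).
transitivity ('C(n, i)%:R * 'C(n, b - i)%:R * (K * (1 / lambda ^+ i))
              * (B h 1 * Q)`_a).
  rewrite -!mulrA; do 2!congr (_ * _).
  have -> : B h 1 * Q =
      B 2%N 2 * (B h 1 * (B h 2 * (B (n - i)%N (2 / lambda) * B (n - (b - i))%N 2))).
    rewrite /Q /B (_ : n + h + 2 - (b - i) = 2 + h + (n - (b - i)))%N; last by lia.
    by rewrite !exprD; ring.
  rewrite -sum_coef5 mulrA !mulr_sumr.
  apply: eq_bigr => i1 _; rewrite !mulr_sumr; apply: eq_bigr => i2 _.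
  rewrite !mulr_sumr; apply: eq_bigr => i3 _; rewrite !mulr_sumr.
  apply: eq_bigr => i4 _; rewrite !mulr_sumr; apply: eq_bigr => i5 _.
  rewrite !coef_binomial expr1n.
  have n0 : (0 < n)%N by lia.
  have := powers_at_half R lambda n h b i i1 i3 i4 i5 l0 n0.
  by rewrite -!mulrA => ->; ring.
rewrite coefM mulr_sumr big_mkord; apply: eq_bigr => i2 _.
have := ltn_ord i2; rewrite ltnS => ia.
rewrite coef_binomial expr1n mulr1.
have -> : Q = (1 + (2 / lambda * (1 - (1 - lambda))) *: 'X) ^+ (n + h + 2 - (b - i))
              * (1 + (2 / lambda) *: 'X) ^+ (n - i).
  by rewrite /Q /B; congr ((1 + _ *: _) ^+ _ * _); field.
rewrite coef_binomialM_hyp2F1; last by lia.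
have -> : (n + h + 2 - (b - i) + (n - i) = 2 * n + h + 2 - b)%N by lia.
have -> : - (n + h + 2 - (b - i))%:R = b%:R - i%:R - n%:R - h%:R - 2 :> R.
  by rewrite natrB ?natrB ?natrD; [ring|lia..].
have -> : - (2 * n + h + 2 - b)%:R = b%:R - 2 * n%:R - h%:R - 2 :> R.
  by rewrite natrB ?natrD ?natrM; [ring|lia..].
by rewrite expr_div_n; ring.
Qed.
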